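(* Let $G$ be a finite group, let $\mathsf{S}$ be a supercharacter theory of $G$, and let $N$ be an $\mathsf{S}$-normal subgroup of $G$. The following hold. (1) For each $\chi\in\mathrm{Ch}(\mathsf{S})$ and $\psi\in\mathrm{Ch}(\mathsf{S}_N)$ satisfying $\langle\psi,\mathrm{Res}^G_N(\chi)\rangle>0$, $\psi(1)$ divides $\chi(1)$. In particular, $\mathrm{Res}^G_N(\chi)$ is a positive integer multiple of an $\mathsf{S}_N$-character. (2) For each $g\in G$, $|\mathrm{cl}_{\mathsf{S}^{G/N}}(gN)|$ divides $|\mathrm{cl}_{\mathsf{S}}(g)|$.
   Context: Let $G$ be a finite group and $\mathrm{Irr}(G)$ its set of complex irreducible characters. A supercharacter theory $\mathsf{S}$ of $G$ is a pair $(\mathcal{X}_{\mathsf{S}},\mathcal{K}_{\mathsf{S}})$, where $\mathcal{X}_{\mathsf{S}}$ is a partition of $\mathrm{Irr}(G)$ and $\mathcal{K}_{\mathsf{S}}$ is a partition of $G$, such that $\{1\}\in\mathcal{K}_{\mathsf{S}}$, $|\mathcal{X}_{\mathsf{S}}|=|\mathcal{K}_{\mathsf{S}}|$, and for each $X\in\mathcal{X}_{\mathsf{S}}$ there is a (nonzero) character $\xi_X$ whose constituents lie in $X$ and which is constant on the parts of $\mathcal{K}_{\mathsf{S}}$. It is known that then every part of $\mathcal{K}_{\mathsf{S}}$ is a union of conjugacy classes, and $\xi_X$ is up to a scalar $\sigma_X=\sum_{\psi\in X}\psi(1)\psi$. The parts of $\mathcal{K}_{\mathsf{S}}$ are called $\mathsf{S}$-classes,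 $\mathrm{Cl}(\mathsf{S})$ is the set of them, and $\mathrm{cl}_{\mathsf{S}}(g)$ is the $\mathsf{S}$-class containing $g$. The characters $\sigma_X$, $X\in\mathcal{X}_{\mathsf{S}}$, are called $\mathsf{S}$-characters, and $\mathrm{Ch}(\mathsf{S})$ is the set of them. A subgroup $N\le G$ is $\mathsf{S}$-normal if it is a union of $\mathsf{S}$-classes. For a character $\chi$, $\mathrm{Irr}(\chi)$ denotes the set of irreducible constituents of $\chi$, and for any finite group $H$ and $Y\subseteq\mathrm{Irr}(H)$, $\sigma_Y=\sum_{\psi\in Y}\psi(1)\psi$. If $N$ is $\mathsf{S}$-normal, then there are (known) induced supercharacter theories $\mathsf{S}_N$ of $N$ and $\mathsf{S}^{G/N}$ of $G/N$: $\mathrm{Ch}(\mathsf{S}_N)=\{\sigma_{\mathrm{Irr}(\mathrm{Res}^G_N(\chi))}:\chi\in\mathrm{Ch}(\mathsf{S})\}$ and $\mathrm{Cl}(\mathsf{S}_N)=\{K\in\mathrm{Cl}(\mathsf{S}):K\subseteq N\}$; the $\mathsf{S}^{G/N}$-classes are the images $\pi(K)$ of the $\mathsf{S}$-classes $K$ under the projection $\pi:G\to G/N$, and the $\mathsf{S}^{G/N}$-characters are the $\mathsf{S}$-characters containing $N$ in their kernel, viewed as characters of $G/N$. $\langle\cdot,\cdot\rangle$ is the usual inner product of class functions. *)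

(* Defs.v *)
From mathcomp Require Export all_boot all_order all_fingroup all_algebra.
From mathcomp Require Export all_solvable all_field all_character.

Set Implicit Arguments.
Unset Strict Implicit.
Unset Printing Implicit Defensive.

Import GroupScope Order.TTheory GRing.Theory Num.Theory.
Local Open Scope ring_scope.

(* Irr(G) is represented by the index type [Iirr G], so subsets of Irr(G) are
   elements of [{set Iirr G}]. This record carries only the data of a
   supercharacter theory; its axioms are [supercharacter_theory]. *)
Record sct_pair (gT : finGroupType) (G : {group gT}) := SctPair {
  sct_irr : {set {set Iirr G}};
  Cl : {set {set gT}}
}.

Definition constant_on (gT : finGroupType) (G : {group gT})
    (K : {set gT}) (phi : 'CF(G)) : Prop :=
  {in K &, forall x y, phi x = phi y}.

Definition supercharacter_theory (gT : finGroupType) (G : {group gT})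
    (S : sct_pair G) : Prop :=
  [/\ partition (sct_irr S) [set: Iirr G],
      partition (Cl S) G,
      [set 1%g] \in Cl S,
      #|sct_irr S| = #|Cl S|
    & forall X, X \in sct_irr S ->
        exists xi : 'CF(G),
          [/\ xi \is a character, xi != 0, {subset irr_constt xi <= X}
            & forall K, K \in Cl S -> constant_on K xi]].

Definition sigma (gT : finGroupType) (G : {group gT}) (Y : {set Iirr G}) :
    'CF(G) :=
  \sum_(i in Y) 'chi_i 1%g *: 'chi_i.

Definition Ch (gT : finGroupType) (G : {group gT}) (S : sct_pair G) :
    seq 'CF(G) :=
  [seq sigma X | X in sct_irr S].

Definition cl (gT : finGroupType) (G : {group gT}) (S : sct_pair G) (g : gT) :
    {set gT} :=
  pblock (Cl S) g.

Definition sct_normal (gT : finGroupType) (G : {group gT}) (S : sct_pair G)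
    (N : {group gT}) : Prop :=
  N \subset G /\
  exists2 P : {set {set gT}}, P \subset Cl S & N = cover P :> {set gT}.

Definition Irr_of (gT : finGroupType) (G : {group gT}) (chi : 'CF(G)) :
    {set Iirr G} :=
  [set i in irr_constt chi].

(* For an S-normal subgroup N, [sct_sub S N] is S_N and [sct_quo S N] is
   S^{G/N}; both are then supercharacter theories. *)
Definition sct_sub (gT : finGroupType) (G : {group gT}) (S : sct_pair G)
    (N : {group gT}) : sct_pair N :=
  @SctPair gT N
    [set Irr_of ('Res[N] (sigma X)) | X : {set Iirr G} in sct_irr S]
    [set K in Cl S | K \subset N].

(* An S-normal N is normal in G, so the projection is defined on all of G and
   [K / N] is the full image of K. *)
Definition sct_quo (gT : finGroupType) (G : {group gT}) (S : sct_pair G)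
    (N : {group gT}) : sct_pair (G / N)%G :=
  @SctPair (coset_of N) (G / N)%G
    [set [set quo_Iirr N i | i in X] |
       X : {set Iirr G} in sct_irr S & N \subset cfker (sigma X)]
    [set (K / N)%g | K : {set gT} in Cl S].

(* Main.v *)
Require Import Defs.
From mathcomp Require Import ring.

(** Call a function a superclass function if it is constant on the S-classes.
    The given characters, one for each block of irreducible characters, are
    independent superclass functions, and there are as many of them as there are
    classes; so they form a basis of the space of superclass functions
    ([block_family_spans]). Expanding the regular character in this basis shows
    that they are multiples of the [sigma X], and then expanding the indicator
    functions of the classes shows that the classes are invariant under
    conjugation. Hence superclass functions are exactly the combinations of the
    [sigma X], that is, the class functions [phi] whose coordinate
    ['[phi, 'chi_i]] is proportional to ['chi_i 1] on each block
    ([superclass_cfdot_irr]).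

    Restriction. Let [phi] be a superclass function on [N]. It is invariant
    under [G], so for a constituent ['chi_j] of ['Res 'chi_i], Clifford's theorem
    and Frobenius reciprocity equate ['[phi, 'chi_j] / 'chi_j 1] with
    ['['Ind phi, 'chi_i] / 'chi_i 1], which depends only on the block of [i].
    Thus the coordinates of [phi] are proportional to the degrees on the set of
    constituents of each ['Res (sigma X)]. Taking for [phi] such a restriction
    shows both that these sets are disjoint or equal and that ['Res (sigma X)]
    is a multiple of the [sigma] of its constituents. The multiple is an
    integer since, by Clifford, the degree of a constituent of ['Res 'chi_i]
    divides the degree of ['chi_i] ([Res_sigma_multiple]).

    Projection. The characters [sigma X] are, up to scalars, orthogonal
    idempotents for convolution, so superclass functions are closed under
    convolution ([superclass_convolution]). Convolving the indicator functions
    of a class [K] and of [N] shows that the number of elements of [K] in the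
    coset of [y] depends only on the class of [y]
    ([card_rcosetI_superclass]). Consequently the images of the classes in the
    quotient are disjoint or equal, and all fibres of the projection of [K] onto
    its image have the same size. *)

Set Implicit Arguments.
Unset Strict Implicit.
Unset Printing Implicit Defensive.

Import GroupScope Order.TTheory GRing.Theory Num.Theory.
Local Open Scope ring_scope.

(** * The space of superclass functions *)

(** The matrix of the family is square with independent rows, hence its rows
    also span; this is where the equality of the number of blocks of
    characters and of the number of classes enters. *)
Lemma free_square_family_spans (F : fieldType) (I J : finType)
    (A : {set I}) (B : {set J}) (M : I -> J -> F) :
    #|A| = #|B| ->
    (forall c : I -> F,
       {in B, forall j, \sum_(i in A) c i * M i j = 0} ->
       {in A, forall i, c i = 0}) ->
  forall f : J -> F,
    exists c : I -> F, {in B, forall j, f j = \sum_(i in A) c i * M i j}.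
Proof.
move=> eqAB freeM f.
pose W := \matrix_(i < #|A|, j < #|B|) M (enum_val i) (enum_val j).
(* The sum has one term or none: it extends [v], whose indices enumerate [A],
   by zero outside [A]. *)
pose ext (v : 'rV[F]_#|A|) i := \sum_(k | enum_val k == i) v 0 k.
have extK v k : ext v (enum_val k) = v 0 k.
  by rewrite /ext (big_pred1 k) // => l; rewrite /= (inj_eq enum_val_inj).
have extE v (j : J) (Bj : j \in B) :
    \sum_(i in A) ext v i * M i j = (v *m W) 0 (enum_rank_in Bj j).
  rewrite mxE big_enum_val; apply: eq_bigr => k _.
  by rewrite extK mxE enum_rankK_in.
have freeW : row_free W.
  apply: inj_row_free => v vW0; apply/rowP=> k; rewrite -extK mxE.
  by apply: freeM => [j Bj|]; rewrite ?enum_valP // (extE v j Bj) vW0 mxE.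
have fullW : row_full W by rewrite /row_full (eqP freeW) eqAB.
have /submxP[v fv] := submx_full (\row_(j < #|B|) f (enum_val j)) fullW.
by exists (ext v) => j Bj; rewrite (extE v j Bj) -fv mxE enum_rankK_in.
Qed.

(** The domain is the whole type [gT], not a class function on a fixed group:
    a function on an S-normal subgroup [N], extended by zero, is then a
    superclass function for the theory [S] of [G] itself, and indicator
    functions qualify before the classes are known to be
    conjugation-invariant. *)
Definition superclass_fun (gT : finGroupType) (G : {group gT})
    (S : sct_pair G) (f : gT -> algC) : Prop :=
  forall K, K \in Cl S -> {in K &, forall x y, f x = f y}.

Lemma sct_class_exists (gT : finGroupType) (G : {group gT}) (S : sct_pair G) x :
  supercharacter_theory S -> x \in G -> exists2 K, K \in Cl S & x \in K.
Proof.
by case=> _ /cover_partition defG _ _ _; rewrite -defG => /bigcupP[K]; exists K.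
Qed.

Lemma sct_class_sub (gT : finGroupType) (G : {group gT}) (S : sct_pair G) K :
  supercharacter_theory S -> K \in Cl S -> K \subset G.
Proof.
case=> _ /cover_partition defG _ _ _ SK.
by rewrite -defG; apply: bigcup_sup SK.
Qed.

Lemma sct_irr_meet_eq (gT : finGroupType) (G : {group gT}) (S : sct_pair G) X Y i :
    supercharacter_theory S -> X \in sct_irr S -> Y \in sct_irr S ->
  i \in X -> i \in Y -> X = Y.
Proof.
case=> /partition_trivIset tiI _ _ _ _ SX SY iX iY.
by rewrite -(def_pblock tiI SX iX) (def_pblock tiI SY iY).
Qed.

Lemma indicator_superclass (gT : finGroupType) (G : {group gT})
    (S : sct_pair G) (P : {set {set gT}}) :
    supercharacter_theory S -> P \subset Cl S ->
  superclass_fun S (fun x => (x \in cover P)%:R).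
Proof.
case=> _ /partition_trivIset tiG _ _ _ /subsetP sPS K SK x y Kx Ky.
congr (nat_of_bool _)%:R.
have inP u v : u \in K -> v \in K -> u \in cover P -> v \in cover P.
  move=> Ku Kv /bigcupP[L PL Lu]; apply/bigcupP; exists L => //.
  by rewrite -(def_pblock tiG (sPS L PL) Lu) (def_pblock tiG SK Ku).
by apply/idP/idP; apply: inP.
Qed.

(** Distinct blocks are disjoint, so an irreducible character in the block [Y]
    sees the [Y]-term of a sum and no other. *)
Lemma cfdot_block_sum (gT : finGroupType) (G : {group gT}) (S : sct_pair G)
    (xi : {set Iirr G} -> 'CF(G)) (c : {set Iirr G} -> algC) Y i :
    supercharacter_theory S ->
    {in sct_irr S, forall X, {subset irr_constt (xi X) <= X}} ->
    Y \in sct_irr S -> i \in Y ->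
  '[\sum_(X in sct_irr S) c X *: xi X, 'chi_i] = c Y * '[xi Y, 'chi_i].
Proof.
move=> hS sub_xi SY iY; rewrite cfdot_suml (bigD1 Y) //= cfdotZl big1 ?addr0 //.
move=> X /andP[SX neqXY]; rewrite cfdotZl [X in _ * X](_ : _ = 0) ?mulr0 //.
apply: contraNeq neqXY; rewrite -irr_consttE => /(sub_xi X SX) iX.
by rewrite (sct_irr_meet_eq hS SX SY iX iY).
Qed.

Lemma cfdot_sigma (gT : finGroupType) (G : {group gT}) (X : {set Iirr G}) i :
  '[sigma X, 'chi_i] = if i \in X then 'chi_i 1%g else 0.
Proof.
rewrite cfdot_suml; have [iX | notiX] := ifPn.
  rewrite (bigD1 i) //= cfdotZl cfnorm_irr mulr1 big1 ?addr0 // => j /andP[_].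
  by rewrite cfdotZl cfdot_irr => /negPf->; rewrite mulr0.
apply: big1 => j jX; rewrite cfdotZl cfdot_irr.
by case: eqP jX notiX => [-> -> //|]; rewrite mulr0.
Qed.

Lemma irr_constt_sigma (gT : finGroupType) (G : {group gT}) (X : {set Iirr G}) :
  {subset irr_constt (sigma X) <= X}.
Proof.
by move=> i; rewrite irr_consttE cfdot_sigma; case: ifP => // _; rewrite eqxx.
Qed.

Lemma sigma_char (gT : finGroupType) (G : {group gT}) (X : {set Iirr G}) :
  sigma X \is a character.
Proof.
apply: rpred_sum => i _; have /natrP[n ->] := Cnat_irr1 i.
by rewrite scaler_nat rpredMn ?irr_char.
Qed.

Lemma sigma_neq0 (gT : finGroupType) (G : {group gT}) (S : sct_pair G) X :
  supercharacter_theory S -> X \in sct_irr S -> sigma X != 0.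
Proof.
case=> /and3P[_ _ irr0] _ _ _ _ SX.
have /set0Pn[i iX] : X != set0 by apply: contraNneq irr0 => <-.
apply: contraTneq (irr1_neq0 i) => sigma0; rewrite negbK.
by have := cfdot_sigma X i; rewrite sigma0 cfdot0l iX => <-.
Qed.

(** Pairing with one constituent of each [xi X] shows that the [xi X] are
    independent; there are as many of them as there are classes, so they form
    a basis of the space of superclass functions. *)
Lemma block_family_spans (gT : finGroupType) (G : {group gT}) (S : sct_pair G)
    (xi : {set Iirr G} -> 'CF(G)) (f : gT -> algC) :
    supercharacter_theory S ->
    {in sct_irr S, forall X,
      [/\ xi X != 0, {subset irr_constt (xi X) <= X} & superclass_fun S (xi X)]} ->
    superclass_fun S f ->
  exists c : {set Iirr G} -> algC,
    {in G, forall x, f x = \sum_(X in sct_irr S) c X * xi X x}.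
Proof.
move=> hS xiP Sf; have [_ _ _ cardS _] := hS.
have [|c cP] := @free_square_family_spans _ _ _ _ _
    (fun X (K : {set gT}) => xi X (repr K)) cardS _ (fun K => f (repr K)).
  move=> c c0 Y SY; pose phi := \sum_(X in sct_irr S) c X *: xi X.
  have phi0 : phi = 0.
    apply/cfun_inP=> x Gx; have [K SK Kx] := sct_class_exists hS Gx.
    rewrite cfunE sum_cfunE -[RHS](c0 K SK); apply: eq_bigr => X SX.
    have [_ _ xiK] := xiP X SX.
    by rewrite cfunE (xiK K SK x (repr K) Kx (mem_repr x Kx)).
  have [xi_neq0 _ _] := xiP Y SY.
  have [i xi_i] := neq0_has_constt xi_neq0.
  have [_ /(_ i xi_i) iY _] := xiP Y SY.
  have sub_xi : {in sct_irr S, forall X, {subset irr_constt (xi X) <= X}}.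
    by move=> X SX; case: (xiP X SX).
  have := cfdot_block_sum c hS sub_xi SY iY; rewrite -/phi phi0 cfdot0l.
  by move/esym/eqP; rewrite mulf_eq0 (negPf xi_i) orbF => /eqP.
exists c => x Gx; have [K SK Kx] := sct_class_exists hS Gx.
have rK := mem_repr x Kx.
rewrite (Sf K SK _ _ Kx rK) cP //; apply: eq_bigr => X SX.
by have [_ _ xiK] := xiP X SX; rewrite (xiK K SK _ _ Kx rK).
Qed.

(** The regular character vanishes off [{1}], which is a class, so it is a
    combination of the given characters [xi]; comparing the components along
    the block [X] makes [sigma X] a multiple of [xi X]. *)
Lemma sigma_superclass (gT : finGroupType) (G : {group gT}) (S : sct_pair G) X :
  supercharacter_theory S -> X \in sct_irr S -> superclass_fun S (sigma X).
Proof.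
move=> hS SX; have [_ _ S1 _ xiP] := hS.
have /fin_all_exists[xi xiS] : forall Y, exists xi : 'CF(G), Y \in sct_irr S ->
    [/\ xi != 0, {subset irr_constt xi <= Y} & superclass_fun S xi].
  move=> Y; have [SY | _] := boolP (Y \in _); last by exists 0.
  by have [xi [_ ? ? ?]] := xiP Y SY; exists xi.
have Sreg : superclass_fun S (cfReg G).
  have /(indicator_superclass hS) Sind1 : [set [set 1%g]] \subset Cl S.
    by rewrite sub1set.
  move=> K SK x y Kx Ky; have := Sind1 K SK x y Kx Ky.
  by rewrite cover1 !inE !cfRegE -!(mulr_natr #|G|%:R) => ->.
have [c cP] := block_family_spans hS xiS Sreg.
have defReg : cfReg G = \sum_(Y in sct_irr S) c Y *: xi Y.
  apply/cfun_inP=> x Gx; rewrite cP // sum_cfunE.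
  by apply: eq_bigr => Y _; rewrite cfunE.
suffices -> : sigma X = c X *: xi X.
  move=> K SK x y Kx Ky; rewrite !cfunE; congr (_ * _).
  by have [_ _ xiK] := xiS X SX; apply: xiK Kx Ky.
rewrite [sigma X]cfun_sum_cfdot [RHS]cfun_sum_cfdot.
apply: eq_bigr => i _; congr (_ *: _); rewrite cfdot_sigma.
have [_ sub_xi _] := xiS X SX.
have [iX | notiX] := ifPn.
  have sub_xiS : {in sct_irr S, forall Y, {subset irr_constt (xi Y) <= Y}}.
    by move=> Y SY; case: (xiS Y SY).
  rewrite cfdotZl -(cfdot_block_sum c hS sub_xiS SX iX) -defReg.
  rewrite cfReg_sum cfdot_suml (bigD1 i) //= cfdotZl cfnorm_irr mulr1 big1 ?addr0 // => j /negPf neq_ji.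
  by rewrite cfdotZl cfdot_irr neq_ji mulr0.
rewrite cfdotZl; apply/esym/eqP; rewrite mulf_eq0; apply/orP; right.
by apply: contraNT notiX => /sub_xi.
Qed.

Lemma superclass_fun_sum_sigma (gT : finGroupType) (G : {group gT})
    (S : sct_pair G) (f : gT -> algC) :
    supercharacter_theory S -> superclass_fun S f ->
  exists c : {set Iirr G} -> algC,
    {in G, forall x, f x = \sum_(X in sct_irr S) c X * sigma X x}.
Proof.
move=> hS Sf; apply: block_family_spans => // X SX.
split; first exact: sigma_neq0 hS SX.
  exact: irr_constt_sigma.
exact: sigma_superclass.
Qed.

(** The indicator function of [K] is a combination of the characters
    [sigma X], hence a class function. *)
Lemma sct_class_normal (gT : finGroupType) (G : {group gT}) (S : sct_pair G) K :
  supercharacter_theory S -> K \in Cl S -> K <| G.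
Proof.
move=> hS SK; have sKG := sct_class_sub hS SK.
apply/andP; split=> //; apply/subsetP=> g Gg; rewrite inE.
apply/subsetP=> _ /imsetP[x Kx ->]; have Gx := subsetP sKG x Kx.
have sKS : [set K] \subset Cl S by rewrite sub1set.
have [c] := superclass_fun_sum_sigma hS (indicator_superclass hS sKS).
rewrite cover1 => cP.
have : ((x ^ g)%g \in K)%:R = (x \in K)%:R :> algC.
  by rewrite !cP ?groupJ //; apply: eq_bigr => X _; rewrite cfunJ.
by rewrite Kx => /eqP; rewrite eqr_nat eqb1.
Qed.

(** A combination of the [sigma X] has coordinates proportional to the degrees
    inside each block. For the indicator function of a class [K], this says
    that the central characters of the members of a block agree on the class
    sum of [K]. *)
Lemma superclass_cfdot_irr (gT : finGroupType) (G : {group gT})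
    (S : sct_pair G) (phi : 'CF(G)) X i j :
    supercharacter_theory S -> superclass_fun S phi ->
    X \in sct_irr S -> i \in X -> j \in X ->
  '[phi, 'chi_i] * 'chi_j 1%g = '[phi, 'chi_j] * 'chi_i 1%g.
Proof.
move=> hS Sphi SX iX jX; have [c cP] := superclass_fun_sum_sigma hS Sphi.
have -> : phi = \sum_(Y in sct_irr S) c Y *: sigma Y.
  apply/cfun_inP=> x Gx; rewrite cP // sum_cfunE.
  by apply: eq_bigr => Y _; rewrite cfunE.
have sub_sigma : {in sct_irr S, forall Y : {set Iirr G},
    {subset irr_constt (sigma Y) <= Y}} by move=> Y _; apply: irr_constt_sigma.
rewrite (cfdot_block_sum c hS sub_sigma SX iX).
rewrite (cfdot_block_sum c hS sub_sigma SX jX) !cfdot_sigma iX jX.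
by rewrite mulrAC.
Qed.

(** * Restriction to an S-normal subgroup *)

Lemma sct_normal_superclass (gT : finGroupType) (G : {group gT})
    (S : sct_pair G) (N : {group gT}) :
    supercharacter_theory S -> sct_normal S N ->
  superclass_fun S (fun x => (x \in N)%:R).
Proof. by move=> hS [_ [P sPS ->]]; apply: indicator_superclass. Qed.

Lemma sct_normal_normal (gT : finGroupType) (G : {group gT})
    (S : sct_pair G) (N : {group gT}) :
  supercharacter_theory S -> sct_normal S N -> N <| G.
Proof.
move=> hS [sNG [P /subsetP sPS defN]]; apply/andP; split=> //.
apply/subsetP=> g Gg; rewrite inE; apply/subsetP=> _ /imsetP[x Nx ->].
move: Nx; rewrite defN => /bigcupP[K PK Kx]; apply/bigcupP; exists K => //.
have /andP[_ /subsetP nKG] := sct_class_normal hS (sPS K PK).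
by rewrite memJ_norm ?nKG.
Qed.

Lemma cfRes_superclass (gT : finGroupType) (G : {group gT})
    (S : sct_pair G) (N : {group gT}) (phi : 'CF(G)) :
    supercharacter_theory S -> sct_normal S N -> superclass_fun S phi ->
  superclass_fun S ('Res[N] phi).
Proof.
move=> hS hN Sphi K SK x y Kx Ky; have [sNG _] := hN.
have eqN : (x \in N) = (y \in N).
  have /eqP := sct_normal_superclass hS hN SK Kx Ky.
  by rewrite eqr_nat; case: (x \in N); case: (y \in N).
have [Ny | notNy] := boolP (y \in N); last by rewrite !cfun0 ?eqN.
by rewrite !cfResE ?eqN //; apply: Sphi Kx Ky.
Qed.

Lemma cfInd_superclass (gT : finGroupType) (G : {group gT})
    (S : sct_pair G) (N : {group gT}) (phi : 'CF(N)) :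
    supercharacter_theory S -> N \subset G -> superclass_fun S phi ->
  superclass_fun S ('Ind[G] phi).
Proof.
move=> hS sNG Sphi K SK x y Kx Ky; rewrite !cfIndE //; congr (_ * _).
have /andP[_ /subsetP nKG] := sct_class_normal hS SK.
by apply: eq_bigr => g Gg; apply: (Sphi K SK); rewrite memJ_norm ?nKG.
Qed.

Lemma superclass_invariant (gT : finGroupType) (G : {group gT})
    (S : sct_pair G) (N : {group gT}) (phi : 'CF(N)) :
    supercharacter_theory S -> N <| G -> superclass_fun S phi ->
  {in G, forall g, (phi ^ g)%CF = phi}.
Proof.
move=> hS /andP[sNG /subsetP nNG] Sphi g Gg; apply/cfun_inP=> x Nx.
rewrite cfConjgE ?nNG //.
have [K SK Kx] := sct_class_exists hS (subsetP sNG x Nx).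
have /andP[_ /subsetP nKG] := sct_class_normal hS SK.
by apply: (Sphi K SK); rewrite ?memJ_norm ?groupV ?nKG.
Qed.

(** By Clifford, the restriction is an integer multiple of a sum of conjugates
    of ['chi_j], which all have the degree of ['chi_j]. *)
Lemma constt_Res_irr1_dvd (gT : finGroupType) (G N : {group gT}) i j :
    N <| G -> j \in irr_constt ('Res[N, G] 'chi_i) ->
  ('chi_j 1%g %| 'chi_i 1%g)%C.
Proof.
move=> nsNG constt_j; rewrite -(cfRes1 N 'chi_i).
rewrite (Clifford_Res_sum_cfclass nsNG constt_j) cfunE dvdC_mull //.
  by rewrite intr_nat // Cnat_cfdot_char ?cfRes_char ?irr_char.
rewrite sum_cfunE big_seq rpred_sum // => _ /cfclassP[y _ ->].
by rewrite cfConjg1 dvdC_refl.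
Qed.

(** An invariant [phi] has the same inner product with each of the conjugates
    of ['chi_j] that make up the restriction of ['chi_i]. *)
Lemma cfdot_Res_invariant (gT : finGroupType) (G N : {group gT})
    (phi : 'CF(N)) i j :
    N <| G -> {in G, forall g, (phi ^ g)%CF = phi} ->
    j \in irr_constt ('Res[N, G] 'chi_i) ->
  '[phi, 'Res[N] 'chi_i] * 'chi_j 1%g = '[phi, 'chi_j] * 'chi_i 1%g.
Proof.
move=> nsNG phiG constt_j; rewrite -(cfRes1 N 'chi_i).
rewrite (Clifford_Res_sum_cfclass nsNG constt_j) cfdotZr cfunE.
rewrite conj_natr ?Cnat_cfdot_char ?cfRes_char ?irr_char //.
rewrite -mulrA [RHS]mulrCA; congr (_ * _).
rewrite sum_cfunE cfdot_sumr mulr_suml mulr_sumr big_seq [RHS]big_seq.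
apply: eq_bigr => _ /cfclassP[y Gy ->]; rewrite cfConjg1.
by rewrite -{1}(phiG y Gy) cfConjg_iso.
Qed.

Lemma constt_Res_sigma (gT : finGroupType) (G N : {group gT})
    (X : {set Iirr G}) j :
    j \in Irr_of ('Res[N] (sigma X)) ->
  exists2 i, i \in X & j \in irr_constt ('Res[N] 'chi_i).
Proof.
rewrite inE irr_consttE linear_sum cfdot_suml => nz.
have [i /andP[iX constt_j] | none] :=
  pickP [pred i in X | j \in irr_constt ('Res[N] 'chi_i)]; first by exists i.
case/eqP: nz; apply: big1 => i iX; rewrite linearZ cfdotZl.
have := none i; rewrite /= iX /= irr_consttE => /negbFE/eqP->.
by rewrite mulr0.
Qed.

(** Proportionality to the degrees passes from the blocks of [S] to the blocks
    of [sct_sub S N]: if ['chi_j] lies under ['chi_i], the ratio of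
    ['[phi, 'chi_j]] to ['chi_j 1] equals that of ['['Ind phi, 'chi_i]] to
    ['chi_i 1], by Clifford and Frobenius reciprocity, and the latter depends
    only on the block of [i] because ['Ind phi] is a superclass function. *)
Lemma superclass_cfdot_Irr_of_Res (gT : finGroupType) (G : {group gT})
    (S : sct_pair G) (N : {group gT}) (phi : 'CF(N)) X j k :
    supercharacter_theory S -> sct_normal S N -> superclass_fun S phi ->
    X \in sct_irr S ->
    j \in Irr_of ('Res[N] (sigma X)) -> k \in Irr_of ('Res[N] (sigma X)) ->
  '[phi, 'chi_j] * 'chi_k 1%g = '[phi, 'chi_k] * 'chi_j 1%g.
Proof.
move=> hS hN Sphi SX /constt_Res_sigma[i iX ij] /constt_Res_sigma[l lX lk].
have nsNG := sct_normal_normal hS hN.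
have phiG := superclass_invariant hS nsNG Sphi.
have eq_j := cfdot_Res_invariant nsNG phiG ij.
have eq_k := cfdot_Res_invariant nsNG phiG lk.
have SInd := cfInd_superclass hS (normal_sub nsNG) Sphi.
have := superclass_cfdot_irr hS SInd SX iX lX.
rewrite -!Frobenius_reciprocity => eq_il.
apply: (mulIf (irr1_neq0 i)); apply: (mulIf (irr1_neq0 l)).
transitivity ('[phi, 'chi_j] * 'chi_i 1%g * ('chi_k 1%g * 'chi_l 1%g)).
  by ring.
rewrite -eq_j.
transitivity ('[phi, 'Res[N] 'chi_i] * 'chi_l 1%g * ('chi_j 1%g * 'chi_k 1%g)).
  by ring.
rewrite eq_il.
transitivity ('[phi, 'Res[N] 'chi_l] * 'chi_k 1%g * ('chi_i 1%g * 'chi_j 1%g)).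
  by ring.
by rewrite eq_k; ring.
Qed.

(** The coordinates of the restriction are proportional to the degrees on its
    constituents, which gives a multiple of [sigma]. The factor, read off at a
    single constituent ['chi_j], is an integer: it is the sum of the
    ['chi_i 1 / 'chi_j 1 * '['Res 'chi_i, 'chi_j]] over [i] in [X], and
    ['chi_j 1] divides ['chi_i 1] whenever the inner product is nonzero. *)
Lemma Res_sigma_multiple (gT : finGroupType) (G : {group gT})
    (S : sct_pair G) (N : {group gT}) X :
    supercharacter_theory S -> sct_normal S N -> X \in sct_irr S ->
  exists2 n : nat, (0 < n)%N &
    'Res[N] (sigma X) = n%:R *: sigma (Irr_of ('Res[N] (sigma X))).
Proof.
move=> hS hN SX; set phi := 'Res[N] (sigma X); set Y := Irr_of phi.
have nsNG := sct_normal_normal hS hN.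
have char_phi : phi \is a character by rewrite cfRes_char ?sigma_char.
have Sphi : superclass_fun S phi.
  exact: cfRes_superclass hS hN (sigma_superclass hS SX).
have [j jY] : exists j, j \in Y.
  have [|j] := @neq0_has_constt _ _ phi; last by exists j; rewrite inE.
  by rewrite cfRes_eq0 ?sigma_char // (sigma_neq0 hS SX).
have nz_j : '[phi, 'chi_j] != 0 by move: jY; rewrite inE.
have [|n def_n] := dvdCP_nat (char1_ge0 (irr_char j))
    (natr_ge0 (Cnat_cfdot_char char_phi (irr_char j))).
  rewrite /phi linear_sum cfdot_suml rpred_sum // => i _; rewrite linearZ cfdotZl.
  have [-> | constt_j] := eqVneq '['Res[N] 'chi_i, 'chi_j] 0.
    by rewrite mulr0 dvdC0.
  rewrite dvdC_mulr ?(constt_Res_irr1_dvd nsNG) //.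
  by rewrite intr_nat // Cnat_cfdot_char ?cfRes_char ?irr_char.
exists n.
  by rewrite lt0n; apply: contraNneq nz_j => n0; rewrite def_n n0 mul0r.
rewrite [LHS]cfun_sum_cfdot [RHS]cfun_sum_cfdot; apply: eq_bigr => k _.
congr (_ *: _); rewrite cfdotZl cfdot_sigma.
have [kY | notkY] := ifPn; last first.
  by apply/eqP; rewrite mulr0; apply: contraNT notkY => nz; rewrite inE.
apply: (mulIf (irr1_neq0 j)).
rewrite -(superclass_cfdot_Irr_of_Res hS hN Sphi SX jY kY) def_n.
by rewrite mulrAC.
Qed.

(** The restriction of [sigma Z] is a superclass function, so its coordinates
    are proportional to the degrees on the constituents of the restriction of
    [sigma X]: if one of them is nonzero, all are. *)
Lemma Irr_of_Res_sigma_eq (gT : finGroupType) (G : {group gT})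
    (S : sct_pair G) (N : {group gT}) X1 X2 j :
    supercharacter_theory S -> sct_normal S N ->
    X1 \in sct_irr S -> X2 \in sct_irr S ->
    j \in Irr_of ('Res[N] (sigma X1)) -> j \in Irr_of ('Res[N] (sigma X2)) ->
  Irr_of ('Res[N] (sigma X1)) = Irr_of ('Res[N] (sigma X2)).
Proof.
move=> hS hN SX1 SX2 j1 j2.
have sub X Z : X \in sct_irr S -> Z \in sct_irr S ->
    j \in Irr_of ('Res[N] (sigma X)) -> j \in Irr_of ('Res[N] (sigma Z)) ->
  {subset Irr_of ('Res[N] (sigma X)) <= Irr_of ('Res[N] (sigma Z))}.
  move=> SX SZ jX jZ k kX.
  have Sphi := cfRes_superclass hS hN (sigma_superclass hS SZ).
  have eq_jk := superclass_cfdot_Irr_of_Res hS hN Sphi SX jX kX.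
  move: jZ; rewrite !inE; apply: contraNneq => dot_k0.
  by move/eqP: eq_jk; rewrite dot_k0 mul0r mulf_eq0 (negPf (irr1_neq0 k)) orbF.
by apply/setP=> k; apply/idP/idP; apply: sub.
Qed.

(** * Projection to the quotient *)

(** Up to the factor [#|G|], the characters [sigma X] are orthogonal idempotents
    for convolution. *)
Lemma sigma_convolution (gT : finGroupType) (G : {group gT})
    (X Y : {set Iirr G}) y :
  \sum_(x in G) sigma X (x * y)%g * sigma Y x^-1%g
    = #|G|%:R * sigma (X :&: Y) y.
Proof.
have conv i j : \sum_(x in G) 'chi[G]_i (x * y)%g * 'chi[G]_j x^-1%g
    = #|G|%:R * ((i == j)%:R * ('chi_i y / 'chi_i 1%g)).
  by rewrite -generalized_orthogonality_relation mulVKf ?neq0CG.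
transitivity (\sum_(i in X) \sum_(j in Y) 'chi_i 1%g * 'chi_j 1%g *
    \sum_(x in G) 'chi[G]_i (x * y)%g * 'chi[G]_j x^-1%g).
  under eq_bigr => x _.
    rewrite !sum_cfunE mulr_suml.
    under eq_bigr => i _ do rewrite mulr_sumr.
    over.
  rewrite exchange_big; apply: eq_bigr => i _.
  rewrite exchange_big; apply: eq_bigr => j _.
  by rewrite mulr_sumr; apply: eq_bigr => x _; rewrite !cfunE mulrACA.
rewrite sum_cfunE mulr_sumr; under [RHS]eq_bigl => i do rewrite in_setI.
rewrite big_mkcondr /=.
apply: eq_bigr => i _; under eq_bigr => j _ do rewrite conv.
have [iY | notiY] := ifPn.
  rewrite (bigD1 i) //= eqxx mul1r big1 ?addr0 => [|j /andP[_ /negPf]].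
    rewrite cfunE mulrCA; congr (_ * _); rewrite -mulrA; congr (_ * _).
    by rewrite mulrC divfK ?irr1_neq0.
  by rewrite eq_sym => ->; rewrite mul0r !mulr0.
apply: big1 => j jY; case: eqP notiY => [-> | _ _]; first by rewrite jY.
by rewrite mul0r !mulr0.
Qed.

Lemma superclass_convolution (gT : finGroupType) (G : {group gT})
    (S : sct_pair G) (f h : gT -> algC) :
    supercharacter_theory S -> superclass_fun S f -> superclass_fun S h ->
  superclass_fun S (fun y => \sum_(x in G) f (x * y)%g * h x^-1%g).
Proof.
move=> hS Sf Sh K SK; have sKG := sct_class_sub hS SK.
have [c cP] := superclass_fun_sum_sigma hS Sf.
have [d dP] := superclass_fun_sum_sigma hS Sh.
have conv y : y \in K -> \sum_(x in G) f (x * y)%g * h x^-1%g =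
    \sum_(X in sct_irr S) \sum_(Y in sct_irr S)
      c X * d Y * (#|G|%:R * sigma (X :&: Y) y).
  move=> Ky; have Gy := subsetP sKG y Ky.
  under eq_bigr => x Gx.
    rewrite cP ?groupM // dP ?groupV // mulr_suml.
    under eq_bigr => X _ do rewrite mulr_sumr.
    over.
  rewrite exchange_big; apply: eq_bigr => X _.
  rewrite exchange_big; apply: eq_bigr => Y _.
  rewrite -sigma_convolution mulr_sumr.
  by apply: eq_bigr => x _; rewrite mulrACA.
move=> y z Ky Kz; rewrite !conv //.
apply: eq_bigr => X SX; apply: eq_bigr => Y SY; congr (_ * (_ * _)).
have [-> | neqXY] := eqVneq X Y.
  by rewrite setIid; apply: (sigma_superclass hS SY SK).
have -> : X :&: Y = set0.
  apply/setP=> i; rewrite !inE; apply: contraNF neqXY => /andP[iX iY].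
  by rewrite (sct_irr_meet_eq hS SX SY iX iY).
by rewrite /sigma big_set0 !cfunE.
Qed.

(** As a function of [y], this cardinality is the convolution of the indicator
    functions of [K] and [N]. *)
Lemma card_rcosetI_superclass (gT : finGroupType) (G : {group gT})
    (S : sct_pair G) (N : {group gT}) K :
    supercharacter_theory S -> sct_normal S N -> K \in Cl S ->
  forall L, L \in Cl S -> {in L &, forall y z,
    #|K :&: N :* y| = #|K :&: N :* z|}.
Proof.
move=> hS hN SK L SL y z Ly Lz; apply/eqP; rewrite -(eqr_nat algC); apply/eqP.
have sNG : N \subset G by case: hN.
have SindK : superclass_fun S (fun x => (x \in K)%:R).
  rewrite -[K]cover1; apply: indicator_superclass => //.
  by rewrite sub1set.
have count t : #|K :&: N :* t|%:R =
    \sum_(x in G) ((x * t)%g \in K)%:R * (x^-1%g \in N)%:R :> algC.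
  rewrite -sum1_card natr_sum big_mkcond (reindex_inj (mulIg t)) /=.
  rewrite [RHS]big_mkcond; apply: eq_bigr => x _.
  rewrite inE mem_rcoset mulgK groupV.
  have [Nx | notNx] := boolP (x \in N).
    by rewrite (subsetP sNG x Nx) mulr1 andbT; case: (_ \in K).
  by rewrite andbF mulr0 if_same.
rewrite !count.
have := superclass_convolution hS SindK (sct_normal_superclass hS hN).
by move=> /(_ L SL y z Ly Lz).
Qed.

(** The classes whose image meets that of [K] at a coset [N :* x] are those [L]
    with [L :&: N :* x] nonempty, a condition that is constant in [x] along
    [K]. *)
Lemma sct_quo_trivIset (gT : finGroupType) (G : {group gT})
    (S : sct_pair G) (N : {group gT}) :
    supercharacter_theory S -> sct_normal S N ->
  trivIset (Cl (sct_quo S N)).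
Proof.
move=> hS hN; have /andP[_ /subsetP nNG] := sct_normal_normal hS hN.
have sub K L k l : K \in Cl S -> L \in Cl S -> k \in K -> l \in L ->
    coset N k = coset N l -> (K / N \subset L / N)%g.
  move=> SK SL Kk Ll eq_kl; have inN M x : M \in Cl S -> x \in M -> x \in 'N(N).
    by move=> SM Mx; apply/nNG/(subsetP (sct_class_sub hS SM)).
  apply/subsetP=> _ /morphimP[x nNx Kx ->].
  have : (0 < #|L :&: N :* x|)%N.
    rewrite (card_rcosetI_superclass hS hN SL SK Kx Kk); apply/card_gt0P.
    exists l; rewrite inE Ll; apply/rcoset_kercosetP; rewrite ?eq_kl //.
      exact: inN SL Ll.
    exact: inN SK Kk.
  case/card_gt0P=> z /setIP[Lz]; have nNz := inN L z SL Lz.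
  by move/(rcoset_kercosetP nNz nNx)=> eq_zx; rewrite /= -eq_zx mem_morphim.
apply/trivIsetP=> _ _ /imsetP[K SK ->] /imsetP[L SL ->].
apply: contraR => /pred0Pn[_ /andP[/morphimP[k _ Kk ->] /morphimP[l _ Ll eq_kl]]].
by rewrite eqEsubset (sub K L k l) // (sub L K l k).
Qed.

(** The fibres of the projection of [K] are the sets [K :&: N :* x] with [x] in
    [K], all of the same size. *)
Lemma card_sct_quo_dvd (gT : finGroupType) (G : {group gT})
    (S : sct_pair G) (N : {group gT}) K :
    supercharacter_theory S -> sct_normal S N -> K \in Cl S ->
  (#|(K / N)%g| %| #|K|)%N.
Proof.
move=> hS hN SK; have /andP[_ /subsetP nNG] := sct_normal_normal hS hN.
have nNK x : x \in K -> x \in 'N(N).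
  by move=> Kx; apply/nNG/(subsetP (sct_class_sub hS SK)).
have [-> | [g Kg]] := set_0Vmem K; first by rewrite cards0 dvdn0.
apply/dvdnP; exists #|K :&: N :* g|.
rewrite -[LHS]sum1_card (partition_big (coset N) [in (K / N)%g]) /=; last first.
  by move=> x Kx; apply: mem_morphim (nNK x Kx) Kx.
rewrite mulnC -sum_nat_const; apply: eq_bigr => _ /morphimP[x nNx Kx ->].
rewrite (card_rcosetI_superclass hS hN SK SK Kg Kx) -sum1_card.
apply: eq_bigl => z; rewrite inE; have [Kz | //] := boolP (z \in K).
by apply/eqP/(rcoset_kercosetP (nNK z Kz) nNx).
Qed.

(** * Divisibility of degrees and of class sizes *)

Theorem theorem1 (gT : finGroupType) (G : {group gT}) (S : sct_pair G)
    (hS : supercharacter_theory S) (N : {group gT}) (hN : sct_normal S N) :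
  ((forall (chi : 'CF(G)) (psi : 'CF(N)), chi \in Ch S -> psi \in Ch (sct_sub S N) ->
      0 < '[psi, 'Res[N] chi] -> (psi 1%g %| chi 1%g)%C)
   /\ (forall chi : 'CF(G), chi \in Ch S ->
         exists2 psi : 'CF(N), psi \in Ch (sct_sub S N) &
         exists2 n : nat, (0 < n)%N & 'Res[N] chi = n%:R *: psi))
  /\ (forall g, g \in G -> (#|cl (sct_quo S N) (coset N g)| %| #|cl S g|)%N).
Proof.
split; [split|].
- move=> _ _ /imageP[X SX ->] /imageP[_ /imsetP[Z SZ ->] ->].
  have [n _ defRes] := Res_sigma_multiple hS hN SX.
  set Y := Irr_of ('Res[N] (sigma X)) in defRes *.
  rewrite {1}defRes cfdotZr => dot_gt0.
  have [j jY jZ] : exists2 j, j \in Y & j \in Irr_of ('Res[N] (sigma Z)).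
    have [j /andP[jY jZ] | none] :=
      pickP [pred j in Y | j \in Irr_of ('Res[N] (sigma Z))]; first by exists j.
    move: dot_gt0; rewrite cfdot_sumr big1 ?mulr0 ?ltxx // => j jY.
    have := none j; rewrite /= jY /= => notjZ.
    by rewrite cfdotZr cfdot_sigma notjZ mulr0.
  rewrite -(Irr_of_Res_sigma_eq hS hN SX SZ jY jZ) -/Y.
  rewrite -(cfRes1 N (sigma X)) defRes cfunE dvdC_mull ?dvdC_refl //.
- move=> _ /imageP[X SX ->]; exists (sigma (Irr_of ('Res[N] (sigma X)))).
    by apply: image_f; apply: imset_f.
  exact: Res_sigma_multiple hS hN SX.
- move=> g Gg; have [K SK Kg] := sct_class_exists hS Gg.
  have [_ /partition_trivIset tiG _ _ _] := hS.
  have nNg : g \in 'N(N).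
    by have /andP[_ /subsetP->] := sct_normal_normal hS hN.
  rewrite /cl (def_pblock tiG SK Kg).
  rewrite (def_pblock (sct_quo_trivIset hS hN) (imset_f _ SK)) ?mem_morphim //.
  exact: card_sct_quo_dvd hS hN SK.
Qed.
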